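(* Let $G=(V,E)$ be an undirected graph and $W\subseteq V$. Let $H$ be the graph with vertex set $\{v_e: e\in E\}\cup\{w': w\in W\}$ (the $w'$ being new vertices) in which $v_e$ and $v_f$ ($e\neq f$) are adjacent iff the edges $e$ and $f$ share an end vertex in $G$, and $w'$ is adjacent to $v_e$ iff $e$ is incident to $w$ in $G$ (no other edges). Let $W_H=\{w':w\in W\}$. For a subgraph $T$ of $G$, let $V_T=\{v_e: e\in E(T)\}$. Then $T$ is a Steiner subgraph of $(G,W)$ if and only if $H[V_T\cup W_H]$ is an induced Steiner subgraph of $(H,W_H)$.
   Context: A Steiner subgraph of $(G,W)$ is a subgraph of $G$ containing a path between every pair of vertices of $W$. An induced Steiner subgraph of $(H,W_H)$ is an induced subgraph of $H$ containing a path between every pair of vertices of $W_H$. *)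

(* Defs.v *)
From mathcomp Require Import all_boot.

Set Implicit Arguments.
Unset Strict Implicit.
Unset Printing Implicit Defensive.

(* Finite simple undirected graphs, with vertices drawn from an ambient finite
   type: a graph and its subgraphs then have the same type. *)
Record graph (T : finType) := Graph {
  vset : {set T};
  eset : {set {set T}};
  eset_card2 : forall e, e \in eset -> #|e| = 2;
  eset_ends : forall e, e \in eset -> e \subset vset
}.

Section Graphs.
Variable T : finType.
Implicit Types (G H S : graph T) (W X : {set T}).

Definition adj G : rel T := fun x y => [set x; y] \in eset G.

Definition subgraph S G : Prop :=
  vset S \subset vset G /\ eset S \subset eset G.

Definition induced_subgraph S G : Prop :=
  subgraph S G /\
  forall e, e \in eset G -> e \subset vset S -> e \in eset S.

Lemma induced_card2 G X e :
  e \in [set e in eset G | e \subset X] -> #|e| = 2.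
Proof. by rewrite inE => /andP[/eset_card2]. Qed.

Lemma induced_ends G X e :
  e \in [set e in eset G | e \subset X] -> e \subset X :&: vset G.
Proof. by rewrite inE subsetI => /andP[/eset_ends -> ->]. Qed.

(* G[X]; its vertex set is X whenever X \subset vset G. *)
Definition induced G X : graph T :=
  Graph (@induced_card2 G X) (@induced_ends G X).

Definition is_path G (x y : T) (p : seq T) : Prop :=
  [/\ {subset x :: p <= vset G}, path (adj G) x p, last x p = y
    & uniq (x :: p)].

(* A pair of vertices consists of two distinct vertices. *)
Definition connects G W : Prop :=
  forall x y, x \in W -> y \in W -> x != y -> exists p, is_path G x y p.

Definition Steiner_subgraph G W S : Prop :=
  subgraph S G /\ connects S W.

Definition induced_Steiner_subgraph G W S : Prop :=
  induced_subgraph S G /\ connects S W.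

Lemma induced_inducedP G X : induced_subgraph (induced G X) G.
Proof.
split; first by split; [exact: subsetIr | apply/subsetP=> e /setIdP[]].
by move=> e eG; rewrite /= inE eG subsetI => /andP[].
Qed.

End Graphs.

Section LineGraph.
Variables (V : finType) (G : graph V) (W : {set V}).

(* inl e is the vertex v_e and inr w is the new vertex w'. *)
Definition Hvert : finType := ({set V} + V)%type.

Definition edge_verts (A : {set {set V}}) : {set Hvert} :=
  [set (inl e : Hvert) | e in A].

Definition terminals : {set Hvert} := [set (inr w : Hvert) | w in W].

Definition Hvset : {set Hvert} := edge_verts (eset G) :|: terminals.

Definition Heset : {set {set Hvert}} :=
  [set [set (inl e : Hvert); inl f]
     | e in eset G, f in eset G & (e != f) && (e :&: f != set0)]
  :|: [set [set (inr w : Hvert); inl e] | w in W, e in eset G & w \in e].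

Lemma Heset_card2 d : d \in Heset -> #|d| = 2.
Proof.
case/setUP=> /imset2P[].
  move=> e f _; rewrite inE => /and3P[_ nef _] ->.
  by rewrite cards2; case: eqP => // -[ef]; rewrite ef eqxx in nef.
by move=> w e _ _ ->; rewrite cards2.
Qed.

Lemma Heset_ends d : d \in Heset -> d \subset Hvset.
Proof.
case/setUP=> /imset2P[].
  move=> e f eG; rewrite inE => /andP[fG _] ->.
  by rewrite subUset !sub1set !inE !imset_f.
move=> w e wW; rewrite inE => /andP[eG _] ->.
by rewrite subUset !sub1set !inE !imset_f ?orbT.
Qed.

Definition Hgraph : graph Hvert := Graph Heset_card2 Heset_ends.

Lemma adj_HgraphE (x y : Hvert) :
  adj Hgraph x y =
  match x, y with
  | inl e, inl f =>
      [&& e \in eset G, f \in eset G, e != f & e :&: f != set0]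
  | inr w, inl e | inl e, inr w => [&& w \in W, e \in eset G & w \in e]
  | inr _, inr _ => false
  end.
Proof.
have E2 (a b c d : Hvert) : [set a; b] = [set c; d] ->
    (a = c /\ b = d) \/ (a = d /\ b = c) \/ (a = b).
  move=> E; have := set21 a b; have := set22 a b; rewrite E !inE.
  have := set21 c d; have := set22 c d; rewrite -E !inE.
  by do 4![case/orP=> /eqP ?]; subst; auto.
apply/idP/idP.
- move=> h; have := Heset_card2 h; rewrite cards2; case: eqP => // nxy _.
  case/setUP: h => /imset2P[].
    move=> e f eG; rewrite inE => /and3P[fG nef ef] /E2.
    case=> [[-> ->]|[[-> ->]|//]]; first by rewrite eG fG nef.
    by rewrite eG fG eq_sym nef setIC.
  move=> w e wW; rewrite inE => /andP[eG we] /E2.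
  by case=> [[-> ->]|[[-> ->]|//]]; rewrite wW eG.
- case: x y => [e|w] [f|u] //.
  + case/and4P=> eG fG nef ef; rewrite /adj /= inE; apply/orP; left.
    by apply/imset2P; exists e f => //; rewrite inE fG nef.
  + case/and3P=> uW eG ue; rewrite /adj /= inE; apply/orP; right.
    by apply/imset2P; exists u e; rewrite ?inE ?eG // setUC.
  case/and3P=> wW fG wf; rewrite /adj /= inE; apply/orP; right.
  by apply/imset2P; exists w f; rewrite ?inE ?fG.
Qed.

End LineGraph.

(* Main.v *)
Require Import Defs.
From mathcomp Require Import all_boot.

(** A walk in [T] traverses edges any two consecutive of which share an end, so
    it is a walk in the line graph, and [w'] is attached to every edge at [w].
    Conversely, let [inl e] touch the two ends of [e] and [inr w] touch [w]:
    along a walk in [H[V_T :|: W_H]] consecutive vertices touch a common vertex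
    of [G], and all vertices touched by one vertex are connected in [T]. *)

Section Connectivity.
Variable T : finType.
Implicit Types (S G : graph T) (W X : {set T}).

Lemma adj_sym S : symmetric (adj S).
Proof. by move=> x y; rewrite /adj setUC. Qed.

Lemma connect_adj_sym S : connect_sym (adj S).
Proof. exact/sym_connect_sym/adj_sym. Qed.

Lemma adj_vset S x y : adj S x y -> (x \in vset S) && (y \in vset S).
Proof.
move=> /eset_ends/subsetP sub.
by rewrite !sub ?set21 ?set22.
Qed.

(** A walk between distinct vertices can be shortened to a simple path. That path is nonempty, so
    each of its vertices is an end of an edge and hence lies in [vset S]. *)
Lemma connectsP S W :
  connects S W <-> {in W &, forall x y, connect (adj S) x y}.
Proof.
split=> [con x y xW yW | con x y xW yW xy].
  have [->|xy] := eqVneq x y; first exact: connect0.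
  have [p [_ pp lp _]] := con x y xW yW xy.
  by apply/connectP; exists p.
have /connectP[p0 pp0 yE] := con x y xW yW.
case/shortenP: pp0 yE => p pp up _ yE.
exists p; split=> // z.
case: p pp yE {up} => [|a p] pp yE; first by rewrite yE eqxx in xy.
rewrite inE => /predU1P[->|]; first by case/andP: pp => /adj_vset/andP[].
elim: p x a pp {xy xW yE p0} => [|b p IH] x a /=.
  by rewrite andbT inE => /adj_vset/andP[_ aS] /eqP->.
case/andP=> /adj_vset/andP[_ aS] pp.
by rewrite inE => /predU1P[->//|]; apply: IH pp.
Qed.

Lemma adj_inducedE G X x y :
  adj (induced G X) x y = [&& adj G x y, x \in X & y \in X].
Proof. by rewrite /adj /= inE subUset !sub1set. Qed.

Lemma connect_edge S e x y :
  e \in eset S -> x \in e -> y \in e -> connect (adj S) x y.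
Proof.
move=> eS xe ye; have [->|xy] := eqVneq x y; first exact: connect0.
apply: connect1; rewrite /adj.
suff -> : [set x; y] = e by [].
apply/eqP; rewrite eqEcard subUset !sub1set xe ye cards2 xy.
by rewrite (eset_card2 eS).
Qed.

(** Take the first edge of the walk. In the line graph this edge is the neighbour through which the
    terminal of [x] is reached. *)
Lemma connect_neq_edge S x y :
  x != y -> connect (adj S) x y -> exists2 e, e \in eset S & x \in e.
Proof.
move=> xy /connectP[[|a p] /= pp yE]; first by rewrite yE eqxx in xy.
by case/andP: pp => xa _; exists [set x; a] => //; rewrite set21.
Qed.

End Connectivity.

Section LineGraphConnectivity.
Variables (V : finType) (G : graph V) (W : {set V}) (T : graph V).
Hypothesis sTG : eset T \subset eset G.

Local Notation X := (edge_verts (eset T) :|: terminals W).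
Local Notation I := (induced (Hgraph G W) X).

Lemma mem_edge_verts_terminals (a : Hvert V) :
  (a \in X) = match a with inl e => e \in eset T | inr w => w \in W end.
Proof.
rewrite inE; case: a => [e|w].
  rewrite mem_imset; last by move=> ? ? [].
  by rewrite orbC; case: imsetP => // -[].
rewrite [_ \in terminals W]mem_imset; last by move=> ? ? [].
by case: imsetP => // -[].
Qed.

Lemma connect_edge_verts x y e f :
  connect (adj T) x y -> e \in eset T -> f \in eset T -> x \in e -> y \in f ->
  connect (adj I) (inl e) (inl f).
Proof.
move=> /connectP[p pp ->] {y} + fT.
(* Two edges with a common end [z] are either equal or adjacent in the line graph. *)
have meet z d d' : d \in eset T -> d' \in eset T -> z \in d -> z \in d' ->
    connect (adj I) (inl d) (inl d').
  move=> dT d'T zd zd'.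
  have [->|dd'] := eqVneq d d'; first exact: connect0.
  apply: connect1; rewrite adj_inducedE adj_HgraphE !mem_edge_verts_terminals.
  rewrite dT d'T dd' !(subsetP sTG) //= andbT.
  by apply/set0Pn; exists z; rewrite inE zd.
elim: p x e pp => [|z p IH] x e /= => [_|/andP[xz pp]] eT xe yf.
  exact: (meet x).
(* Pass from [e] to the first edge of the walk through [x]; that edge also contains [z], where the
   rest of the walk starts. *)
apply: connect_trans (meet x e [set x; z] eT xz xe (set21 x z)) _.
exact: (IH z) (set22 x z) yf.
Qed.

Definition touches (a : Hvert V) (v : V) : bool :=
  match a with inl e => v \in e | inr w => v == w end.

Lemma connect_touched (a : Hvert V) u v :
  a \in X -> touches a u -> touches a v -> connect (adj T) u v.
Proof.
rewrite mem_edge_verts_terminals; case: a => [e|w] /=; first exact: connect_edge.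
by move=> _ /eqP-> /eqP->; apply: connect0.
Qed.

Lemma adj_touches a b : adj I a b -> exists2 z, touches a z & touches b z.
Proof.
rewrite adj_inducedE adj_HgraphE => /and3P[+ _ _].
case: a b => [e|w] [f|w'] //=.
- by case/and4P=> _ _ _ /set0Pn[z /setIP[]]; exists z.
- by case/and3P=> _ _; exists w'.
- by case/and3P=> _ _; exists w.
Qed.

(** Each step of the walk supplies a vertex [z] touched by both of its ends: [u] is joined to [z]
    within [a], and induction continues from [z]. *)
Lemma connect_touches a b u v :
  a \in X -> connect (adj I) a b -> touches a u -> touches b v ->
  connect (adj T) u v.
Proof.
move=> + /connectP[p pp ->] {b}.
elim: p a u pp => [|b p IH] a u /= => [_|/andP[ab pp]] aX au bv.
  exact: connect_touched aX au bv.
have [z az bz] := adj_touches _ _ ab.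
have bX : b \in X by move: ab; rewrite adj_inducedE => /and3P[].
exact: connect_trans (connect_touched _ _ _ aX au az) (IH _ _ pp bX bz bv).
Qed.

Lemma connect_terminals x y : x \in W -> y \in W ->
  connect (adj I) (inr x) (inr y) = connect (adj T) x y.
Proof.
move=> xW yW; apply/idP/idP => [con|con].
  by apply: connect_touches con _ _; rewrite ?mem_edge_verts_terminals //=.
(* The case [x = y] is separate because [x] may then be isolated in [T], with no edge to leave
   by. *)
have [->|xy] := eqVneq x y; first exact: connect0.
have [e eT xe] := connect_neq_edge _ _ _ _ xy con.
have [f fT yf] : exists2 f, f \in eset T & y \in f.
  (* The edge at [y] comes from the reversed walk. *)
  by apply: (connect_neq_edge _ _ y x); rewrite 1?eq_sym // connect_adj_sym.
have spoke w d : w \in W -> d \in eset T -> w \in d -> adj I (inr w) (inl d).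
  move=> wW dT wd.
  rewrite adj_inducedE adj_HgraphE !mem_edge_verts_terminals.
  by rewrite wW dT wd (subsetP sTG).
apply: connect_trans (connect1 (spoke x e xW eT xe)) _.
apply: connect_trans (connect_edge_verts _ _ _ _ con eT fT xe yf) _.
by apply: connect1; rewrite adj_sym; apply: spoke.
Qed.

End LineGraphConnectivity.

Theorem theorem7p1 (V : finType) (G : graph V) (W : {set V})
    (hW : W \subset vset G) (T : graph V) (hT : subgraph T G) :
  Steiner_subgraph G W T <->
  induced_Steiner_subgraph (Hgraph G W) (terminals W)
    (induced (Hgraph G W) (edge_verts (eset T) :|: terminals W)).
Proof.
have sTG := hT.2.
(* Both subgraph conditions hold outright, so only connectivity of the terminals has to be
   transferred. *)
split=> [[_ /connectsP con]|[_ /connectsP con]].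
  split; first exact: induced_inducedP.
  apply/connectsP=> _ _ /imsetP[x xW ->] /imsetP[y yW ->].
  by rewrite connect_terminals //; apply: con.
split=> //; apply/connectsP=> x y xW yW.
rewrite -(connect_terminals _ G W) //.
by apply: con; apply: imset_f.
Qed.
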